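(* For every gauge function $\varphi$ there exists a separable metric space $(X,d)$ of cardinality $\operatorname{cov}\mathcal{M}$ with $\mathcal{H}^{\varphi}(X)>0$.
   Context: A gauge function is a strictly increasing bijection $\varphi:[0,\infty)\to[0,\infty)$, and $\mathcal{H}^{\varphi}$ is the Hausdorff measure with gauge $\varphi$, i.e. $\mathcal{H}^\varphi(X)=\lim_{\delta\to0}\inf\{\sum_i\varphi(\operatorname{diam}E_i): X\subset\bigcup_i E_i,\ \operatorname{diam}E_i\le\delta\}$. $\mathcal{M}$ is the collection of first category subsets of $\mathbb{R}$ and $\operatorname{cov}\mathcal{M}$ is the least cardinality of a family of first category subsets of $\mathbb{R}$ covering $\mathbb{R}$. *)

(* Defs.v *)
From Stdlib Require Import Reals Lra.
Open Scope R_scope.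

(** Gauge function: strictly increasing bijection [0,oo) -> [0,oo),
    represented by a function R -> R whose behaviour outside [0,oo) is irrelevant. *)
Definition gauge (phi : R -> R) : Prop :=
  (forall x, 0 <= x -> 0 <= phi x) /\
  (forall y, 0 <= y -> exists x, 0 <= x /\ phi x = y) /\
  (forall x y, 0 <= x -> x < y -> phi x < phi y).

Definition closureR (A : R -> Prop) (y : R) : Prop :=
  forall e, 0 < e -> exists a, A a /\ Rabs (a - y) < e.

Definition nowhere_dense (A : R -> Prop) : Prop :=
  ~ (exists x e, 0 < e /\ forall y, Rabs (y - x) < e -> closureR A y).

Definition first_category (A : R -> Prop) : Prop :=
  exists N : nat -> (R -> Prop),
    (forall n, nowhere_dense (N n)) /\
    (forall x, A x -> exists n, N n x).

(** "T has cardinality cov M": T indexes a family of first category sets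
    covering R, and T injects into the index type of every such family,
    i.e. |T| is the least cardinality of a first-category cover of R. *)
Definition has_card_covM (T : Type) : Prop :=
  (exists F : T -> (R -> Prop),
      (forall t, first_category (F t)) /\ (forall x, exists t, F t x)) /\
  (forall (I : Type) (F : I -> (R -> Prop)),
      (forall i, first_category (F i)) -> (forall x, exists i, F i x) ->
      exists f : T -> I, forall t1 t2, f t1 = f t2 -> t1 = t2).

Definition is_metric {T : Type} (d : T -> T -> R) : Prop :=
  (forall x y, 0 <= d x y) /\
  (forall x y, d x y = 0 <-> x = y) /\
  (forall x y, d x y = d y x) /\
  (forall x y z, d x z <= d x y + d y z).

Definition separable {T : Type} (d : T -> T -> R) : Prop :=
  exists (D : T -> Prop) (c : T -> nat),
    (forall x y, D x -> D y -> c x = c y -> x = y) /\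
    (forall x e, 0 < e -> exists y, D y /\ d x y < e).

Definition is_diam {T : Type} (d : T -> T -> R) (E : T -> Prop) (D : R) : Prop :=
  ((forall x, ~ E x) /\ D = 0) \/
  ((exists x, E x) /\ is_lub (fun r => exists x y, E x /\ E y /\ r = d x y) D).

(** The (possibly infinite) sum of the nonnegative series a is >= c. *)
Definition series_ge (a : nat -> R) (c : R) : Prop :=
  forall l, infinite_sum a l -> c <= l.

Definition Hdelta_ge {T : Type} (phi : R -> R) (d : T -> T -> R) (delta c : R) : Prop :=
  forall (E : nat -> (T -> Prop)) (D : nat -> R),
    (forall x : T, exists i, E i x) ->
    (forall i, is_diam d (E i) (D i)) ->
    (forall i, D i <= delta) ->
    series_ge (fun i => phi (D i)) c.

(** H^phi(X) > 0.  Since H^phi(X) = lim_{delta->0} H^phi_delta(X) = sup_delta H^phi_delta(X),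
    this holds iff H^phi_delta(X) >= c for some delta > 0 and c > 0. *)
Definition Hausdorff_pos {T : Type} (phi : R -> R) (d : T -> T -> R) : Prop :=
  exists delta c, 0 < delta /\ 0 < c /\ Hdelta_ge phi d delta c.

(* Main.v *)
(** Let [T], a subset of [R], index a first category cover of [R] of least
    cardinality.  By (the hard half of) Bartoszynski's characterisation of
    cov(M), some family [f : T -> nat -> nat] is such that no single [g] meets
    every [f t] infinitely often.  Encode [t] as a sequence [x t] whose [n]-th
    term records [f] at the roughly [n 2^n] positions reserved for level [n],
    and metrise [T] by [d t t' = eps n], where [n] is the first difference of
    [x t] and [x t'] and [phi (eps n) = 2^-n].  Covers of [T] with small
    [phi]-sums contain few sets of each level [n], so that each of them can be
    given a position of its own at that level, where all its members have the
    same [f]-value.  If [H^phi(T)] were zero, a sequence of such covers would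
    thus yield a [g] meeting every [f t] infinitely often. *)
Require Import Defs.
From Stdlib Require Import Reals Lra Lia.
From mathcomp Require Import all_boot boolp classical_sets.
Set Implicit Arguments.
Unset Strict Implicit.

Close Scope R_scope.
Open Scope nat_scope.

(** * Guessing functions infinitely often *)

(** By Bartoszynski's theorem this amounts to |T| < cov(M). *)
Definition guessable (T : Type) : Prop :=
  forall f : T -> nat -> nat, exists g : nat -> nat,
    forall t N, exists2 n, N <= n & f t n = g n.

(** The guess is optional because a number guessed for [pickle (f t n)] may code no element of
    [V]. *)
Lemma guessable_count (T : Type) (V : countType) (f : T -> nat -> V) :
  guessable T -> exists g : nat -> option V,
    forall t N, exists2 n, N <= n & g n = Some (f t n).
Proof.
move=> /(_ (fun t n => pickle (f t n))) [g gP].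
exists (fun n => unpickle (g n)) => t N; have [n leNn fg] := gP t N.
by exists n => //; rewrite -fg pickleK.
Qed.

Lemma infinite_seq (X : nat -> Prop) (m n : nat) :
  (forall N, exists2 k, N <= k & X k) ->
  exists l : seq nat, [/\ uniq l, size l = n & forall x, x \in l -> m <= x /\ X x].
Proof.
move=> Xinf; elim: n => [|n [l [ul sl lX]]]; first by exists [::].
have [k lek Xk] := Xinf (m + (\max_(x <- l) x).+1).
exists (k :: l); split => /=.
- rewrite ul andbT; apply/negP => kl.
  have : k <= \max_(x <- l) x.
    exact: (leq_bigmax_seq (P := xpredT) (F := id) k kl).
  by rewrite leqNgt (leq_trans _ lek) // leq_addl.
- by rewrite sl.
- move=> x; rewrite inE => /orP [/eqP ->|/lX //]; split=> //.
  by apply: leq_trans lek; rewrite leq_addr.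
Qed.

Section FreshPick.
Variables (V : countType) (h : nat -> seq (nat * V)).

Definition pick_fresh (n : nat) (u : seq nat) : option (nat * V) :=
  ohead [seq p <- h n | p.1 \notin u].

(** Greedy choice of distinct positions: a stage takes its first pair at a position that no earlier
    stage took, or nothing if there is none. *)
Fixpoint used (n : nat) : seq nat :=
  if n is m.+1 then
    if pick_fresh m (used m) is Some p then p.1 :: used m else used m
  else [::].

Lemma size_used n : size (used n) <= n.
Proof.
elim: n => //= n IH; case: pick_fresh => [p|] //=.
exact: leq_trans IH _.
Qed.

Lemma used_le m n x : m <= n -> x \in used m -> x \in used n.
Proof.
elim: n => [|n IH]; first by rewrite leqn0 => /eqP ->.
rewrite leq_eqVlt => /orP [/eqP -> //|]; rewrite ltnS => le /(IH le) xu /=.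
by case: pick_fresh => [p|] //; rewrite inE xu orbT.
Qed.

Lemma pick_freshP n p : pick_fresh n (used n) = Some p ->
  [/\ p \in h n, p.1 \notin used n & p.1 \in used n.+1].
Proof.
move=> E; have : p \in [seq p <- h n | p.1 \notin used n].
  by move: E; rewrite /pick_fresh; case: filter => //= a s [->]; rewrite inE eqxx.
by rewrite mem_filter => /andP [pu ph]; split; rewrite //= E inE eqxx.
Qed.

Lemma pick_fresh_inj m n p q :
  pick_fresh m (used m) = Some p -> pick_fresh n (used n) = Some q ->
  p.1 = q.1 -> m = n.
Proof.
move=> /[dup] Ep /pick_freshP [_ pm pS] /[dup] Eq /pick_freshP [_ qn qS] E.
case: (ltngtP m n) => // lt.
- by move: qn; rewrite -E (used_le lt pS).
- by move: pm; rewrite E (used_le lt qS).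
Qed.

(** Pigeonhole: the earlier stages take at most [n] positions, and [h n] offers more than [n]
    distinct ones. *)
Lemma pick_fresh_some n : uniq (map fst (h n)) -> n < size (h n) ->
  exists p, pick_fresh n (used n) = Some p.
Proof.
move=> uh sh; case E: (pick_fresh n (used n)) => [p|]; first by exists p.
exfalso; have sub : {subset map fst (h n) <= used n}.
  move=> x /mapP [p ph ->]; apply/negPn/negP => pu.
  have : p \in [seq p <- h n | p.1 \notin used n] by rewrite mem_filter pu.
  by move: E; rewrite /pick_fresh; case: filter.
have := leq_trans (uniq_leq_size uh sub) (size_used n).
by rewrite size_map leqNgt sh.
Qed.

End FreshPick.

(* To hit [f t] inside [X t], guess at [n] the restriction of [f t] to [n + 1]
   points of [X t]: one of them was not used by the first [n] guesses. *)
Lemma guess_within (T : Type) (V : countType) (f : T -> nat -> V)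
    (X : T -> nat -> Prop) :
  guessable T -> (forall t N, exists2 n, N <= n & X t n) ->
  exists g : nat -> option V,
    forall t N, exists n, [/\ N <= n, X t n & g n = Some (f t n)].
Proof.
move=> gT Xinf.
(* [L (t, n)] has [n + 1] points of [X t], all at least [n], so that a late correct guess concerns a
   late point. *)
have [L LP] := choice (fun p : T * nat => @infinite_seq (X p.1) p.2 p.2.+1 (Xinf p.1)).
pose f' t n : seq (nat * V) := [seq (x, f t x) | x <- L (t, n)].
have [g gP] := guessable_count f' gT.
pose h n := odflt [::] (g n).
(* No two stages pick the same position, so a value satisfying [W x] exists. *)
pose W x (v : option V) := forall n p,
  pick_fresh h n (used h n) = Some p -> p.1 = x -> v = Some p.2.
have [G GP] : {G : nat -> option V & forall x, W x (G x)}.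
  apply: choice => x.
  case: (pselect (exists n p, pick_fresh h n (used h n) = Some p /\ p.1 = x)).
  - move=> [n [p [Ep px]]]; exists (Some p.2) => m q Eq qx.
    have mn : m = n by apply: pick_fresh_inj Eq Ep _; rewrite qx.
    by move: Eq; rewrite mn Ep => -[->].
  - by move=> no; exists None => n p Ep px; case: no; exists n, p.
exists G => t N; have [n leNn gn] := gP t N.
have [/= uL sL LX] := LP (t, n).
have hn : h n = f' t n by rewrite /h gn.
have [||p Ep] := @pick_fresh_some _ h n.
- by rewrite hn -map_comp map_id_in.
- by rewrite hn size_map sL.
have [] := pick_freshP Ep; rewrite hn => /mapP [x xL px] _ _.
have [lex Xx] := LX x xL.
exists x; split=> //; first exact: leq_trans lex.
by rewrite (GP x n p Ep) px.
Qed.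

(** Let [K t a] bound [H t b n] for [b, n <= a], guess [K t (K t m)] by [g m], and let [j] outgrow
    [g]. If the guess at [m] is right and [j n <= m < j n.+1], then [n] works, or else
    [j n.+1 < H t (j n) n <= K t m] and [n.+1] works: [H t (j n.+1) n.+1 <= K t (K t m) = g m <= j
    n.+2]. *)
Lemma guess_escape (T : Type) (H : T -> nat -> nat -> nat) :
  guessable T -> exists j : nat -> nat,
    [/\ j 0 = 0, (forall n, j n <= j n.+1) &
     forall t N, exists2 n, N <= n & H t (j n) n <= j n.+1].
Proof.
move=> gT.
pose K t a := \max_(b < a.+1) \max_(n < a.+1) H t b n.
have HK t b n a : b <= a -> n <= a -> H t b n <= K t a.
  rewrite -ltnS -(ltnS n) => ba na.
  apply: leq_trans (leq_bigmax (Ordinal ba)).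
  exact: (leq_bigmax (F := fun n : 'I_a.+1 => H t b n) (Ordinal na)).
have K_mono t a b : a <= b -> K t a <= K t b.
  move=> ab; apply/bigmax_leqP => i _; apply/bigmax_leqP => k _.
  by apply: HK; apply: leq_trans ab; rewrite -ltnS.
have [g gP] := gT (fun t m => K t (K t m)).
pose j := fix j n := if n is m.+1 then
  maxn (j m).+1 (\max_(i < (j m).+1) g i) else 0.
have jS n : j n < j n.+1 by rewrite /= leq_max leqnn.
have jg n m : m <= j n -> g m <= j n.+1.
  rewrite -ltnS => lt /=; rewrite leq_max; apply/orP; right.
  exact: (leq_bigmax (F := fun i : 'I_(j n).+1 => g i) (Ordinal lt)).
have j_mono := homo_leq leqnn leq_trans (fun n => ltnW (jS n)).
have j_id n : n <= j n by elim: n => // n IH; apply: leq_ltn_trans (jS n).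
exists j; split=> // [n|t N]; first exact/ltnW.
have [m lem fg] := gP t (j N).
have [n [jn jn1]] : exists n, j n <= m /\ m < j n.+1.
  have ex : exists n, m < j n by exists m.+1; apply: j_id.
  case: (ex_minnP ex) => -[|n] mj min; first by rewrite ltn0 in mj.
  by exists n; split=> //; rewrite leqNgt; apply/negP => /min; rewrite ltnn.
have leN : N <= n.
  rewrite leqNgt; apply/negP => /j_mono; rewrite leqNgt => /negP; apply.
  exact: leq_ltn_trans lem jn1.
case: (leqP (H t (j n) n) (j n.+1)) => [le|lt]; first by exists n.
exists n.+1; first exact: leqW.
have le1 : j n.+1 <= K t m.
  apply: leq_trans (ltnW lt) _; apply: HK => //.
  exact: leq_trans (j_id n) jn.
apply: leq_trans (jg _ _ (ltnW jn1)); rewrite -fg.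
by apply: HK => //; apply: leq_trans le1; apply: j_id.
Qed.

Lemma injective_unbounded (h : nat -> nat) :
  injective h -> forall N, exists k, N <= h k.
Proof.
move=> hI N; case: (pselect (exists k, N <= h k)) => // no; exfalso.
have sub : {subset map h (iota 0 N.+1) <= iota 0 N}.
  move=> x /mapP [k _ ->]; rewrite mem_iota /= add0n ltnNge.
  by apply/negP => le; apply: no; exists k.
have uh : uniq (map h (iota 0 N.+1)) by rewrite map_inj_uniq ?iota_uniq.
by have := uniq_leq_size uh sub; rewrite size_map !size_iota ltnn.
Qed.

(** * Rational intervals and first category sets *)

Open Scope R_scope.

(** With [code s = (u, w)], the number [s] names the interval [u/(w+1), (u+1)/(w+1)]; the default
    makes a number that codes no pair name [0,1]. *)
Definition code (s : nat) : nat * nat := odflt (0%N, 0%N) (unpickle s).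
Definition lo (s : nat) : R := INR (code s).1 / (INR (code s).2 + 1).
Definition hi (s : nat) : R := (INR (code s).1 + 1) / (INR (code s).2 + 1).

Lemma lo_lt_hi s : lo s < hi s.
Proof.
rewrite /lo /hi /Rdiv; have := pos_INR (code s).2 => p.
apply: Rmult_lt_compat_r; last lra.
apply: Rinv_0_lt_compat; lra.
Qed.

Lemma lo_ge0 s : 0 <= lo s.
Proof.
rewrite /lo /Rdiv; have p := pos_INR (code s).2; have q := pos_INR (code s).1.
apply: Rmult_le_pos => //; apply/Rlt_le/Rinv_0_lt_compat; lra.
Qed.

Lemma exists_code c d : 0 <= c -> c < d -> exists s, c <= lo s /\ hi s <= d.
Proof.
move=> c0 cd.
(* The mesh 1/(w+1) is less than half of [d - c], so the first cell starting after [c] ends before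
   [d]. *)
have [w w_large] : exists w : nat, 2 / (d - c) < INR w.
  by have [w] := INR_unbounded (2 / (d - c)); exists w.
have w0 := pos_INR w; have W0 : 0 < INR w + 1 by lra.
have [u1 u2] := archimed (c * (INR w + 1)).
have cw : 0 <= c * (INR w + 1) by nra.
have up0 : (0 <= up (c * (INR w + 1)))%Z by apply: le_IZR; lra.
have [u uE] := IZN _ up0.
exists (pickle (u, w)); rewrite /lo /hi /code pickleK /=.
have uR : INR u = IZR (up (c * (INR w + 1))) by rewrite uE INR_IZR_INZ.
have w2 : 2 < (d - c) * (INR w + 1).
  have -> : 2 = (d - c) * (2 / (d - c)) by field; lra.
  by apply: Rmult_lt_compat_l; lra.
split.
- apply: (Rmult_le_reg_r (INR w + 1)) => //.
  rewrite /Rdiv Rmult_assoc Rinv_l; lra.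
- apply: (Rmult_le_reg_r (INR w + 1)) => //.
  rewrite /Rdiv Rmult_assoc Rinv_l; nra.
Qed.

Definition subint (s' s : nat) : Prop := lo s <= lo s' /\ hi s' <= hi s.

(** Some interior point of the interval lies off the closure of [A], and a small coded interval near
    that point misses [A]. *)
Lemma subint_avoid (A : R -> Prop) s : nowhere_dense A ->
  exists s', subint s' s /\ forall y, lo s' <= y <= hi s' -> ~ A y.
Proof.
move=> nd; have lh := lo_lt_hi s; have l0 := lo_ge0 s.
case: (pselect (exists y, Rabs (y - (lo s + hi s) / 2) < (hi s - lo s) / 2
                          /\ ~ closureR A y)); last first.
  move=> no; exfalso; apply: nd; exists ((lo s + hi s) / 2), ((hi s - lo s) / 2).
  split; first lra.
  move=> y yx; case: (pselect (closureR A y)) => // nc.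
  by exfalso; apply: no; exists y.
move=> [y [/Rabs_def2 [y1 y2] ncl]].
have [e [e0 eP]] : exists e, 0 < e /\ forall a, A a -> ~ (Rabs (a - y) < e).
  case: (pselect (exists e, 0 < e /\ forall a, A a -> ~ (Rabs (a - y) < e))) => // no.
  exfalso; apply: ncl => e e0.
  case: (pselect (exists a, A a /\ Rabs (a - y) < e)) => // no'.
  by exfalso; apply: no; exists e; split=> // a Aa ay; apply: no'; exists a.
have [||s' [s1 s2]] := @exists_code (Rmax (lo s) (y - e / 2)) (Rmin (hi s) (y + e / 2)).
- exact: Rle_trans l0 (Rmax_l _ _).
- by apply: Rmax_lub_lt; apply: Rmin_glb_lt; lra.
have := Rmax_l (lo s) (y - e / 2); have := Rmax_r (lo s) (y - e / 2).
have := Rmin_l (hi s) (y + e / 2); have := Rmin_r (hi s) (y + e / 2).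
move=> m1 m2 m3 m4; exists s'; split; first by split; lra.
by move=> z zs Az; apply: (eP z Az); apply: Rabs_def1; lra.
Qed.

Lemma subint_avoid_upto (N : nat -> R -> Prop) :
  (forall m, nowhere_dense (N m)) -> forall n s,
  exists s', subint s' s /\
    forall m, (m <= n)%N -> forall y, lo s' <= y <= hi s' -> ~ N m y.
Proof.
move=> nd; elim=> [|n IH] s.
  have [s' [sub av]] := subint_avoid s (nd 0%N).
  by exists s'; split=> // m; rewrite leqn0 => /eqP ->.
have [s1 [[a1 b1] av1]] := IH s.
have [s2 [[a2 b2] av2]] := subint_avoid s1 (nd n.+1).
exists s2; split; first by split; lra.
move=> m; rewrite leq_eqVlt => /orP [/eqP -> //|lt] y ys.
by apply: (av1 m lt); lra.
Qed.

Lemma nested_subint (s : nat -> nat) : (forall n, subint (s n.+1) (s n)) ->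
  exists y, forall n, lo (s n) <= y <= hi (s n).
Proof.
move=> sS.
have mono n k : subint (s (n + k)%N) (s n).
  elim: k => [|k IH]; first by rewrite addn0; split; lra.
  by rewrite addnS; have := sS (n + k)%N; move: IH => [? ?] [? ?]; split; lra.
have lh m n : lo (s m) <= hi (s n).
  have [? _] := mono m n; have [_] := mono n m.
  by rewrite addnC; have := lo_lt_hi (s (m + n)%N); lra.
have [||y [ub lub]] := completeness (fun r => exists n, r = lo (s n)).
- by exists (hi (s 0%N)) => r [n ->].
- by exists (lo (s 0%N)), 0%N.
exists y => n; split; first by apply: ub; exists n.
by apply: lub => r [m ->].
Qed.

(* Bartoszynski's theorem.  First escape the functions bounding the codes of
   the intervals that avoid the nowhere dense sets; codes below [j n] can then
   be extended below [j n.+1] infinitely often, by finite maps to be guessed. *)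
Lemma guessable_not_cover (T : Type) (F : T -> R -> Prop) : guessable T ->
  (forall t, first_category (F t)) -> exists y, forall t, ~ F t y.
Proof.
move=> gT Fcat.
have [N NP] := choice Fcat.
(* [e (t, (n, s))] codes a subinterval of [s] that avoids the first [n + 1] nowhere dense sets of
   [F t]. *)
have [e eP] := choice (fun p : T * (nat * nat) =>
  subint_avoid_upto (proj1 (NP p.1)) p.2.1 p.2.2).
have [j [j0 jS jP]] := @guess_escape T
  (fun t a n => \max_(s < a.+1) e (t, (n, s : nat)))%N gT.
have [g gP] := guess_within (fun t n => [seq e (t, (n, s)) | s <- iota 0 (j n).+1])
  gT jP.
pose c n s := nth 0%N (odflt [::] (g n)) s.
(* A guess is followed only if it names a subinterval with code at most [j m.+1]; wrong guesses thus
   spoil neither the nesting nor the bound [s n <= j n]. *)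
pose s := fix s n := if n is m.+1 then
  if (c m (s m) <= j n)%N && `[< subint (c m (s m)) (s m) >] then c m (s m) else s m
  else 0%N.
have s_j n : (s n <= j n)%N.
  elim: n => [|n IH] //; rewrite [s _]/=.
  by case: ifP => [/andP [] //|_]; apply: leq_trans IH (jS n).
have s_sub n : subint (s n.+1) (s n).
  rewrite [s n.+1]/=; case: ifP => [/andP [_ /asboolP] //|_]; split; lra.
have [y yP] := nested_subint s_sub.
exists y => t Fty; have [m Nm] := proj2 (NP t) y Fty.
(* At [n] the guess is right and its code small enough to be followed, so [s n.+1] avoids the [m]-th
   nowhere dense set. *)
have [n [mn Xn gn]] := gP t m.
have [sub av] := eP (t, (n, s n)).
have cE : c n (s n) = e (t, (n, s n)).
  rewrite /c gn; apply: etrans (nth_map 0%N _ _ _) _; rewrite ?size_iota ?ltnS ?s_j //.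
  by rewrite nth_iota ?ltnS ?s_j.
have sE : s n.+1 = e (t, (n, s n)).
  rewrite [s n.+1]/= cE asboolT // andbT ifT //.
  apply: leq_trans Xn; have lt : (s n < (j n).+1)%N by rewrite ltnS s_j.
  exact: (leq_bigmax (F := fun s : 'I_(j n).+1 => e (t, (n, s : nat))) (Ordinal lt)).
by apply: (av m mn y) Nm; have := yP n.+1; rewrite sE.
Qed.

(** * The first-difference metric *)

Section FirstDifference.
Variables (T : Type) (x : T -> nat -> nat) (eps : nat -> R).
Hypothesis x_inj : forall t t', (forall n, x t n = x t' n) -> t = t'.
Hypothesis eps_gt0 : forall n, 0 < eps n.
Hypothesis eps_anti : forall m n, (m <= n)%N -> eps n <= eps m.
Hypothesis eps_small : forall e, 0 < e -> exists n, eps n < e.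

Definition fdist (t t' : T) : R :=
  if pselect (exists n, x t n != x t' n) is left ex then eps (ex_minn ex) else 0.

Variant fdist_spec (t t' : T) : R -> Prop :=
| FdistEq of t = t' : fdist_spec t t' 0
| FdistNeq n of x t n <> x t' n & (forall m, (m < n)%N -> x t m = x t' m) :
    fdist_spec t t' (eps n).

Lemma fdistP t t' : fdist_spec t t' (fdist t t').
Proof.
rewrite /fdist; case: pselect => [ex|no].
- case: ex_minnP => n /eqP nx min; constructor=> // m mn.
  by apply/eqP/negPn/negP => /min; rewrite leqNgt mn.
- constructor; apply: x_inj => n; apply/eqP/negPn/negP => nx.
  by apply: no; exists n.
Qed.

Lemma fdist_ge t t' n : x t n <> x t' n -> eps n <= fdist t t'.
Proof.
case: fdistP => [-> //|m xm mP xn]; apply: eps_anti.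
by rewrite leqNgt; apply/negP => /mP.
Qed.

Lemma fdist_ge0 t t' : 0 <= fdist t t'.
Proof. by case: fdistP => [_|n _ _]; [lra|apply: Rlt_le]. Qed.

Lemma fdist_le t t' n : (forall m, (m < n)%N -> x t m = x t' m) ->
  fdist t t' <= eps n.
Proof.
case: fdistP => [_ _|m xm mP nP]; first exact: Rlt_le.
by apply: eps_anti; rewrite leqNgt; apply/negP => /nP.
Qed.

Lemma fdist_metric : is_metric fdist.
Proof.
have refl t : fdist t t = 0 by case: fdistP.
split; first exact: fdist_ge0.
split.
  move=> t t'; split=> [|<-]; last exact: refl.
  by case: fdistP => // n _ _ E; have := eps_gt0 n; lra.
have sym t t' : fdist t t' <= fdist t' t.
  case: fdistP => [_|n nx _]; first exact: fdist_ge0.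
  by apply: fdist_ge => E; apply: nx.
split; first by move=> t t'; apply: Rle_antisym; apply: sym.
move=> t u v; have p1 := fdist_ge0 t u; have p2 := fdist_ge0 u v.
case: (fdistP t v) => [_|n nx _]; first lra.
(* Where [t] and [v] differ, [u] differs from one of them. *)
case: (pselect (x t n = x u n)) => [E|/fdist_ge]; last lra.
have /fdist_ge : x u n <> x v n by rewrite -E.
lra.
Qed.

(** One representative for each finite prefix that occurs gives a countable dense set. *)
Lemma fdist_separable : separable fdist.
Proof.
pose pre n t := [seq x t m | m <- iota 0 n].
pose W (k : nat * seq nat) (o : option T) :=
  forall t, pre k.1 t = k.2 -> exists2 u, o = Some u & pre k.1 u = k.2.
have [r rP] : {r : nat * seq nat -> option T & forall k, W k (r k)}.
  apply: choice => k; case: (pselect (exists t, pre k.1 t = k.2)) => [[t tk]|no].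
  - by exists (Some t) => _ _; exists t.
  - by exists None => t tk; case: no; exists t.
pose D u := exists k, r k = Some u.
have [c cP] : {c : T -> nat * seq nat & forall u, D u -> r (c u) = Some u}.
  apply: (choice (P := fun u k => D u -> r k = Some u)) => u.
  case: (pselect (D u)) => [[k kE]|no]; first by exists k.
  by exists (0%N, [::]).
exists D, (fun u => pickle (c u)); split.
  move=> u v Du Dv /(pcan_inj pickleK) E.
  by have := cP u Du; rewrite E (cP v Dv) => -[->].
move=> t e e0; have [n ne] := eps_small e0.
have [u uE up] := rP (n, pre n t) t erefl.
exists u; split; first by exists (n, pre n t).
apply: Rle_lt_trans ne; apply: fdist_le => m mn.
by have /eq_in_map/(_ m) := up; rewrite mem_iota /= add0n mn => /(_ isT).
Qed.

(** Take for [n] the first coordinate at which two members of [E] differ; if there is none, [E] has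
    at most one point. *)
Lemma diam_agree (E : T -> Prop) (D : R) : is_diam fdist E D ->
  (exists2 n, eps n <= D &
     forall t t', E t -> E t' -> forall m, (m < n)%N -> x t m = x t' m) \/
  (forall t t', E t -> E t' -> t = t').
Proof.
case=> [[E0 _]|[_ [ub _]]]; first by right=> t t' /E0.
case: (pselect (exists n, `[< exists t t', [/\ E t, E t' & x t n <> x t' n] >])).
- move=> ex; left; case: (ex_minnP ex) => n /asboolP [t [t' [Et Et' nx]]] min.
  exists n; first by apply: Rle_trans (fdist_ge nx) _; apply: ub; exists t, t'.
  move=> u u' Eu Eu' m mn; case: (pselect (x u m = x u' m)) => // ne.
  have /min : `[< exists t t', [/\ E t, E t' & x t m <> x t' m] >].
    by apply/asboolP; exists u, u'.
  by rewrite leqNgt mn.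
- move=> no; right=> t t' Et Et'; apply: x_inj => n.
  case: (pselect (x t n = x t' n)) => // ne.
  by case: no; exists n; apply/asboolP; exists t, t'.
Qed.

End FirstDifference.

(** * Powers of 1/2 and the scale of a gauge *)

Lemma half_pow_gt0 n : 0 < (/ 2) ^ n.
Proof. by apply: pow_lt; lra. Qed.

Lemma half_pow_le m n : (m <= n)%N -> (/ 2) ^ n <= (/ 2) ^ m.
Proof.
move=> /subnKC <-; elim: (n - m)%N => [|k IH]; first by rewrite addn0; lra.
by rewrite addnS /=; have := half_pow_gt0 (m + k)%N; lra.
Qed.

Lemma half_pow_small e : 0 < e -> exists n, (/ 2) ^ n < e.
Proof.
move=> e0; have [|n nP] := pow_lt_1_zero (/ 2) _ e e0.
  by rewrite Rabs_pos_eq; lra.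
exists n; have := nP n (le_n n); rewrite Rabs_pos_eq //.
exact/Rlt_le/half_pow_gt0.
Qed.

Section GaugeScale.
Variable phi : R -> R.
Hypothesis gphi : gauge phi.

Lemma gauge_le a b : 0 <= a -> a <= b -> phi a <= phi b.
Proof.
have [_ [_ inc]] := gphi => a0 [ab|<-]; last lra.
exact/Rlt_le/inc.
Qed.

Lemma gauge_lt_inv a b : 0 <= b -> phi a < phi b -> a < b.
Proof.
move=> b0 ab; case: (Rlt_le_dec a b) => // ba.
by have := gauge_le b0 ba; lra.
Qed.

Lemma gauge0 : phi 0 = 0.
Proof.
have [pos [sur inc]] := gphi; have [z [z0 zE]] := sur 0 (Rle_refl 0).
have := gauge_le (Rle_refl 0) z0; have := pos 0 (Rle_refl 0); lra.
Qed.

Lemma gauge_scale : exists eps : nat -> R,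
  [/\ forall n, phi (eps n) = (/ 2) ^ n, forall n, 0 < eps n,
      forall m n, (m <= n)%N -> eps n <= eps m &
      forall e, 0 < e -> exists n, eps n < e].
Proof.
have [pos [sur inc]] := gphi.
have [eps epsP] := choice (fun n => sur _ (Rlt_le _ _ (half_pow_gt0 n))).
have eps_ge0 n : 0 <= eps n by case: (epsP n).
have phie n : phi (eps n) = (/ 2) ^ n by case: (epsP n).
exists eps; split=> //.
- move=> n; case: (eps_ge0 n) => // E.
  by have := half_pow_gt0 n; rewrite -phie -E gauge0; lra.
- move=> m n mn; apply: Rnot_lt_le => lt; have := inc _ _ (eps_ge0 m) lt.
  by rewrite !phie; have := half_pow_le mn; lra.
- move=> e e0; have pe : 0 < phi e by have := inc 0 e (Rle_refl 0) e0; rewrite gauge0.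
  have [n nP] := half_pow_small pe; exists n.
  by apply: gauge_lt_inv; [lra|rewrite phie].
Qed.

End GaugeScale.

(** * Covers with small sums *)

(* The pair [(nu i, occ nu i)] determines [i]: it is the position at level
   [nu i] given to the [i]-th set of a cover. *)
Definition occ (nu : nat -> nat) (i : nat) : nat :=
  count (fun j => nu j == nu i) (iota 0 i).

Lemma occ_lt nu i i' : nu i = nu i' -> (i < i')%N -> (occ nu i < occ nu i')%N.
Proof.
rewrite /occ => <- /subnKC <-; rewrite -[i.+1]addn1 !iotaD !count_cat /= eqxx addn0.
by rewrite !addn1 leq_addr.
Qed.

Lemma occ_inj nu i i' : nu i = nu i' -> occ nu i = occ nu i' -> i = i'.
Proof.
move=> E oE; case: (ltngtP i i') => // lt.
- by have := occ_lt E lt; rewrite oE ltnn.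
- by have := occ_lt (esym E) lt; rewrite oE ltnn.
Qed.

(** Each earlier set of level [nu i] contributes 2^-(nu i) to a sum that is at most 1. *)
Lemma occ_le (nu : nat -> nat) i : sum_f_R0 (fun j => (/ 2) ^ nu j) i <= 1 ->
  (occ nu i <= 2 ^ nu i)%N.
Proof.
move=> le1.
have cnt N : INR (count (fun j => nu j == nu i) (iota 0 N.+1)) * (/ 2) ^ nu i
    <= sum_f_R0 (fun j => (/ 2) ^ nu j) N.
  elim: N => [|N IH].
    rewrite /=; case: eqP => [->|_] /=; first lra.
    by have := half_pow_gt0 (nu 0%N); lra.
  rewrite -[N.+2]addn1 iotaD count_cat plus_INR tech5.
  move: (INR (count _ (iota 0 N.+1))) IH => A IH; rewrite /=.
  by case: eqP => [->|_] /=; [|have := half_pow_gt0 (nu N.+1)]; lra.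
have {}cnt : INR (occ nu i) * (/ 2) ^ nu i <= 1.
  apply: Rle_trans le1; apply: Rle_trans (cnt i).
  apply: Rmult_le_compat_r; first exact/Rlt_le/half_pow_gt0.
  by apply/le_INR/leP; rewrite -[i.+1]addn1 iotaD count_cat leq_addr.
apply/leP/INR_le; apply: (Rmult_le_reg_r ((/ 2) ^ nu i)); first exact: half_pow_gt0.
suff -> : INR (2 ^ nu i) * (/ 2) ^ nu i = 1 by [].
elim: (nu i) => [|n IH]; first by rewrite /=; lra.
rewrite expnS mult_INR /= -[RHS]IH; field.
Qed.

Lemma sum_half_pow m N : sum_f_R0 (fun i => (/ 2) ^ (i + m)) N <= 2 * (/ 2) ^ m.
Proof.
suff : sum_f_R0 (fun i => (/ 2) ^ (i + m)) N = 2 * (/ 2) ^ m - (/ 2) ^ (N + m).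
  by have := half_pow_gt0 (N + m)%N; lra.
elim: N => [|N IH]; first by rewrite /= add0n; lra.
by rewrite tech5 IH addSn /=; lra.
Qed.

Lemma small_cover (T : Type) (x : T -> nat -> nat) (eps : nat -> R) (phi : R -> R) :
  gauge phi -> (forall t t', (forall n, x t n = x t' n) -> t = t') ->
  (forall n, phi (eps n) = (/ 2) ^ n) -> (forall n, 0 < eps n) ->
  (forall m n, (m <= n)%N -> eps n <= eps m) ->
  ~ Hausdorff_pos phi (fdist x eps) ->
  forall k, exists (E : nat -> T -> Prop) (nu : nat -> nat),
  [/\ forall t, exists i, E i t,
      forall i t t', E i t -> E i t' -> forall m, (m < nu i)%N -> x t m = x t' m &
      forall N, sum_f_R0 (fun i => (/ 2) ^ nu i) N <= (/ 2) ^ k].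
Proof.
move=> gphi x_inj phie eps_gt0 eps_anti npos k.
(* The bound 2^-(k+1) leaves the other half of 2^-k for the rounding errors 2^-(i+k+2). *)
have /existsNP [E /existsNP [D]] : ~ Hdelta_ge phi (fdist x eps) 1 ((/ 2) ^ k.+1).
  move=> H; apply: npos; exists 1, ((/ 2) ^ k.+1); split; first lra.
  by split=> //; apply: half_pow_gt0.
move=> /not_implyP [cov /not_implyP [diam /not_implyP [_ /existsNP [l]]]].
move=> /not_implyP [suml /Rnot_le_lt ltl].
have D0 i : 0 <= D i.
  case: (diam i) => [[_ ->]|[[t Et] [ub _]]]; first lra.
  by apply: (Rle_trans _ _ _ (fdist_ge0 x_inj eps_gt0 t t)); apply: ub; exists t, t.
have phiD0 i : 0 <= phi (D i) by case: gphi => pos _; apply: pos.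
(* The error term provides for sets of at most one point: they have no first difference and
   [phi (D i)] vanishes. *)
pose W i n := (/ 2) ^ n <= phi (D i) + (/ 2) ^ (i + k.+2) /\
  forall t t', E i t -> E i t' -> forall m, (m < n)%N -> x t m = x t' m.
have [nu nuP] : {nu : nat -> nat & forall i, W i (nu i)}.
  apply: choice => i.
  case: (diam_agree x_inj eps_anti (diam i)) => [[n leD agr]|one].
  - exists n; split=> //; rewrite -phie.
    have := gauge_le gphi (Rlt_le _ _ (eps_gt0 n)) leD.
    by have := half_pow_gt0 (i + k.+2); lra.
  - exists (i + k.+2)%N; split; first by have := phiD0 i; lra.
    by move=> t t' Et Et'; rewrite (one t t').
exists E, nu; split=> //; first by move=> i; case: (nuP i).
move=> N.
have := sum_Rle (fun i => (/ 2) ^ nu i) (fun i => phi (D i) + (/ 2) ^ (i + k.+2)) N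
  (fun i _ => proj1 (nuP i)).
rewrite sum_plus.
have := sum_incr (fun i => phi (D i)) N l suml phiD0.
have := sum_half_pow k.+2 N.
by move: ltl => /=; lra.
Qed.

(** * From null measure to a guess *)

Lemma gauge_metric (phi : R -> R) (T : Type) (f c : T -> nat -> nat) : gauge phi ->
  (forall t t', (forall n, c t n = c t' n) -> t = t') ->
  exists d : T -> T -> R, [/\ is_metric d, separable d &
    ~ Hausdorff_pos phi d ->
    exists g, forall t N, exists2 n, (N <= n)%N & f t n = g n].
Proof.
move=> gphi c_inj; have [eps [phie eps_gt0 eps_anti eps_small]] := gauge_scale gphi.
(* [L m] lists the positions of level [m + 1], since agreement below [nu] includes coordinate
   [nu - 1]. The component [c t m] makes [x] injective. *)
pose L m := [seq pickle (k, m.+1, p) | k <- iota 0 m.+2, p <- iota 0 (2 ^ m.+1).+1].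
pose x t m := pickle (c t m, [seq f t q | q <- L m]).
have x_inj t t' : (forall n, x t n = x t' n) -> t = t'.
  by move=> xE; apply: c_inj => n; have /(pcan_inj pickleK) [] := xE n.
exists (fdist x eps); split.
- exact: fdist_metric.
- exact: fdist_separable.
move=> npos.
(* Sums at most 2^-(k+1) force [k < nu k i], so that [L] has room for the index [k]. *)
have := fun k => small_cover gphi x_inj phie eps_gt0 eps_anti npos k.+1.
move=> /choice [E /choice [nu EP]].
have cov k t : exists i, E k i t by case: (EP k) => + _ _; apply.
have agr k i t t' : E k i t -> E k i t' ->
    forall m, (m < nu k i)%N -> x t m = x t' m by case: (EP k) => _ + _; apply.
have sums k N : sum_f_R0 (fun i => (/ 2) ^ nu k i) N <= (/ 2) ^ k.+1.
  by case: (EP k).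
pose pos k i := pickle (k, nu k i, occ (nu k) i).
have pos_inj k i k' i' : pos k i = pos k' i' -> k = k' /\ i = i'.
  move=> /(pcan_inj pickleK) [<- En Eo]; split=> //; exact: occ_inj En Eo.
have nu_gt k i : (k < nu k i)%N.
  rewrite ltnNge; apply/negP => le; have := half_pow_le le.
  have : (/ 2) ^ nu k i <= (/ 2) ^ k.+1.
    apply: Rle_trans (sums k i); case: i {le} => [|i]; first by rewrite /=; lra.
    rewrite tech5; have : 0 <= sum_f_R0 (fun i => (/ 2) ^ nu k i) i.
      by apply: cond_pos_sum => j; apply/Rlt_le/half_pow_gt0.
    lra.
  by have := half_pow_gt0 k => /=; lra.
have posL k i : pos k i \in L (nu k i).-1.
  have E1 : (nu k i).-1.+1 = nu k i by rewrite prednK // (leq_ltn_trans _ (nu_gt k i)).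
  rewrite /L E1; apply/allpairsP; exists (k, occ (nu k) i); split=> //.
  - by rewrite mem_iota add0n /= ltnS ltnW.
  - rewrite mem_iota add0n /= ltnS; apply: occ_le; apply: Rle_trans (sums k i) _.
    exact: (@half_pow_le 0).
have fpos k i t t' : E k i t -> E k i t' -> f t (pos k i) = f t' (pos k i).
  move=> Et Et'; have lt : ((nu k i).-1 < nu k i)%N.
    by rewrite prednK // (leq_ltn_trans _ (nu_gt k i)).
  have /(pcan_inj pickleK)/(congr1 snd)/eq_in_map := agr k i t t' Et Et' _ lt.
  by apply; apply: posL.
(* A position belongs to at most one set, on which [f] is constant there. *)
pose W q v := forall k i t, pos k i = q -> E k i t -> f t q = v.
have [g gP] : {g : nat -> nat & forall q, W q (g q)}.
  apply: choice => q.
  case: (pselect (exists k i t, pos k i = q /\ E k i t)) => [[k [i [t [kq Et]]]]|no].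
  - exists (f t q) => k' i' t' kq' Et'; move: (kq'); rewrite -kq => /pos_inj [ek ei].
    by move: Et'; rewrite ek ei => Et'; apply: fpos.
  - by exists 0%N => k i t kq Et; case: no; exists k, i, t.
exists g => t N.
(* [t] lies in a set of each cover, and distinct covers use distinct positions. *)
have [i iP] := choice (fun k => cov k t).
have [k Nk] : exists k, (N <= pos k (i k))%N.
  by apply: injective_unbounded => k k' /pos_inj [].
by exists (pos k (i k)) => //; apply: gP (iP k).
Qed.

(** * A type of cardinality cov(M) *)

(* Hönig's argument: take a maximal family of choice functions on which every
   coordinate is injective; by maximality some coordinate is onto. *)
Lemma least_cardinal (U : Type) (P : (U -> Prop) -> Prop) : (exists S, P S) ->
  exists S, P S /\ forall S', P S' ->
    exists f : {u | S u} -> {u | S' u}, injective f.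
Proof.
move=> [S0 PS0].
pose Q (A : set ((U -> Prop) -> U)) :=
  (forall a, A a -> forall S, P S -> S (a S)) /\
  (forall a b, A a -> A b -> forall S S', P S -> P S' -> a S = b S -> a S' = b S').
have [|A [[A1 A2] Amax]] := @Zorn_bigcup _ Q.
  move=> F FQ Ftot; split.
  - by move=> a [X FX Xa] S PS; case: (FQ X FX) => H _; apply: (H a Xa S PS).
  - move=> a b [X FX Xa] [Y FY Yb] S S' PS PS'.
    have [XY|YX] := Ftot X Y FX FY.
    + by case: (FQ Y FY) => _; apply=> //; apply: XY.
    + by case: (FQ X FX) => _; apply=> //; apply: YX.
case: (pselect (exists S, P S /\ forall u, S u -> exists2 a, A a & a S = u)).
- move=> [S [PS onto]]; exists S; split=> // S' PS'.
  (* The injection sends [u] to [a S'], where [a] is the member of [A] with [a S = u]. *)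
  have [a aP] := choice (fun u : {u | S u} =>
    let: ex_intro2 a Aa aE := onto _ (proj2_sig u) in
    ex_intro (fun a => A a /\ a S = proj1_sig u) a (conj Aa aE)).
  exists (fun u => exist S' (a u S') (A1 _ (proj1 (aP u)) S' PS')).
  move=> u v /(congr1 (@proj1_sig _ _)) /= E.
  apply: eq_sig_hprop => [? ? ?|]; first exact: Prop_irrelevance.
  rewrite -(proj2 (aP u)) -(proj2 (aP v)).
  by apply: A2 E => //; [case: (aP u)|case: (aP v)].
- move=> no; exfalso.
  (* A missed point in every [S] yields a choice function that could be added to [A]. *)
  have miss S : exists u, P S -> S u /\ forall a, A a -> a S <> u.
    case: (pselect (P S)) => [PS|nP].
    + case: (pselect (exists u, S u /\ forall a, A a -> a S <> u)) => [[u]|no'].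
        by exists u.
      case: no; exists S; split=> // u Su.
      case: (pselect (exists2 a, A a & a S = u)) => // no''.
      by case: no'; exists u; split=> // a Aa aE; apply: no''; exists a.
    (* Off [P] any point serves; were [U] empty, [S0] would be onto vacuously. *)
    + case: (pselect (exists u : U, True)) => [[u _]|noU]; first by exists u.
      case: no; exists S0; split=> // u; by case: noU; exists u.
  have [b bP] := choice miss.
  apply: (Amax (fun a => A a \/ a = b)).
  + split; first by move=> a; left.
    move=> /(_ b (or_intror erefl)) Ab.
    by case: (bP S0 PS0) => _ /(_ b Ab).
  + split.
    * by move=> a [/A1 //|-> S /bP []].
    * move=> a a' [Aa|->] [Aa'|->] S S' PS PS' //; first exact: A2.
      - by case: (bP S PS) => _ /(_ a Aa).
      - by case: (bP S PS) => _ /(_ a' Aa') ne E; case: ne.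
Qed.

Lemma first_category_singleton a : first_category (fun y => y = a).
Proof.
exists (fun _ y => y = a); split; last by move=> y ya; exists 0%N.
move=> _ [x [e [e0 cl]]].
have far y : y <> a -> ~ closureR (fun y => y = a) y.
  move=> ne clo; have [|b [-> ]] := clo (Rabs (a - y)).
    by apply: Rabs_pos_lt; lra.
  exact: Rlt_irrefl.
case: (Req_dec x a) => [E|ne].
- apply: (far (x + e / 2)); first lra.
  by apply: cl; rewrite Rabs_pos_eq; lra.
- by apply: (far x ne); apply: cl; rewrite Rminus_diag Rabs_R0.
Qed.

(** Subsets of R suffice as index sets: choosing for each real a member of a cover that contains it,
    and then one real for each chosen member, gives a subset of R that injects into the index type
    and indexes a subcover. *)
Lemma exists_card_covM : exists S : R -> Prop, has_card_covM {u | S u}.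
Proof.
pose P (S : R -> Prop) := exists F : {u | S u} -> R -> Prop,
  (forall t, first_category (F t)) /\ (forall x, exists t, F t x).
have [|S [PS Smin]] := @least_cardinal R P.
  exists (fun _ => True), (fun t y => y = proj1_sig t); split.
    by move=> t; apply: first_category_singleton.
  by move=> y; exists (exist _ y I).
exists S; split=> // J F Fcat Fcov.
have [f fP] := choice Fcov.
have [r rP] : {r : J -> R & forall i, (exists y, f y = i) -> f (r i) = i}.
  apply: (choice (P := fun i z => (exists y, f y = i) -> f z = i)) => i.
  case: (pselect (exists y, f y = i)) => [[y yE]|no].
    by exists y.
  by exists 0 => /no.
pose S' y := r (f y) = y.
have [|h h_inj] := Smin S'.
  exists (fun t => F (f (proj1_sig t))); split; first by move=> t; apply: Fcat.
  move=> y; have E : f (r (f y)) = f y by apply: rP; exists y.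
  have Sy : S' (r (f y)) by rewrite /S' E.
  by exists (exist _ _ Sy); rewrite /= E.
exists (fun t => f (proj1_sig (h t))) => t t' E; apply: h_inj.
apply: eq_sig_hprop => [? ? ?|]; first exact: Prop_irrelevance.
by rewrite -(proj2_sig (h t)) -(proj2_sig (h t')) E.
Qed.

(** If [up (a * INR n)] and [up (b * INR n)] agree for all [n], then |a - b| n <= 1 for all [n]. *)
Lemma real_code : exists c : R -> nat -> nat,
  forall a b, (forall n, c a n = c b n) -> a = b.
Proof.
pose zc (z : Z) := pickle (Z.to_nat z, Z.to_nat (- z)).
have zc_inj z z' : zc z = zc z' -> z = z'.
  by move=> /(pcan_inj pickleK) [e1 e2]; lia.
exists (fun a n => zc (up (a * INR n))) => a b ab.
have near n : Rabs (a - b) * INR n <= 1.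
  have E := zc_inj _ _ (ab n); have n0 := pos_INR n.
  have [] := archimed (a * INR n); have [] := archimed (b * INR n); rewrite E.
  move=> b1 b2 a1 a2; rewrite -(Rabs_pos_eq (INR n)) // -Rabs_mult.
  by apply: Rabs_le; lra.
case: (Req_dec a b) => // ne.
have d0 : 0 < Rabs (a - b) by apply: Rabs_pos_lt; lra.
have [n nP] := INR_unbounded (/ Rabs (a - b)).
have := near n; have := Rmult_lt_compat_l _ _ _ d0 nP.
rewrite Rinv_r; lra.
Qed.

Theorem theorem3p8 :
  forall phi : R -> R, gauge phi ->
  exists (T : Type) (d : T -> T -> R),
    is_metric d /\ separable d /\ has_card_covM T /\ Hausdorff_pos phi d.
Proof.
move=> phi gphi; have [S covS] := exists_card_covM.
have [c c_inj] := real_code.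
have [[F [Fcat Fcov]] _] := covS.
(* The cover [F] yields a family [f] that no [g] guesses; positivity then follows by
   contraposition. *)
have /existsNP [f fP] : ~ guessable {u | S u}.
  by move=> /guessable_not_cover /(_ Fcat) [y yP]; have [t /yP] := Fcov y.
have [||d [dm ds dP]] := @gauge_metric phi _ f (fun t => c (proj1_sig t)) => //.
  move=> t t' /c_inj E.
  by apply: eq_sig_hprop => // ? ? ?; apply: Prop_irrelevance.
exists {u | S u}, d; do 3!split=> //.
by case: (pselect (Hausdorff_pos phi d)) => // /dP.
Qed.
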